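(* Let $I$ be the set of independent sets of a matroid of rank $k$ on ground set $N$, and let $F:2^N\to\mathbb{R}$ be an $\varepsilon$-approximately submodular function ($0\le\varepsilon<1$) with submodular representative $f$. If $S$ is the set returned by the matroid greedy algorithm, then $$F(S)\geq \frac12\left(\frac{1-\varepsilon}{1+\varepsilon}\right)\frac{1}{1+\frac{k\varepsilon}{1-\varepsilon}}\max_{T\in I}f(T).$$ In particular, for $k\ge2$, any constant $0\le\delta<1$ and $\varepsilon=\frac{\delta}{k}$, this approximation ratio is constant and lower-bounded by $\frac12-2\delta$.
   Context: Submodular functions are normalized ($f(\emptyset)=0$) and monotone. $F$ is $\varepsilon$-approximately submodular if there exists a submodular $f$ (a representative of $F$) with $(1-\varepsilon)f(S)\leq F(S)\leq(1+\varepsilon)f(S)$ for all $S\subseteq N$. The matroid greedy algorithm: start with $S=\emptyset$ and a candidate set $M=N$; while $M\ne\emptyset$, let $x^*\in\arg\max_{x\in M}F(S\cup\{x\})$, add $x^*$ to $S$ if $S\cup\{x^*\}\in I$, and remove $x^*$ from $M$; return $S$. *)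

(* Defs.v *)
From mathcomp Require Import all_boot all_order all_algebra.
From mathcomp Require Import reals.

Set Implicit Arguments.
Unset Strict Implicit.
Unset Printing Implicit Defensive.

Import Order.TTheory GRing.Theory Num.Theory.
Local Open Scope ring_scope.

Record matroid (N : finType) (I : {set {set N}}) : Prop := Matroid {
  matroid_set0 : set0 \in I;
  matroid_sub : forall A B : {set N}, B \in I -> A \subset B -> A \in I;
  matroid_exchange : forall A B : {set N}, A \in I -> B \in I ->
    (#|A| < #|B|)%N -> exists2 x, x \in B :\: A & A :|: [set x] \in I
}.

Definition matroid_rank (N : finType) (I : {set {set N}}) : nat :=
  \max_(A in I) #|A|.

(* As usual in maximization, submodular functions are taken to be normalized
   and monotone. *)
Record submodular (R : realType) (N : finType) (f : {set N} -> R) : Prop :=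
  Submodular {
    submodular_set0 : f set0 = 0;
    submodular_mono : forall A B : {set N}, A \subset B -> f A <= f B;
    submodular_UI : forall A B : {set N}, f (A :|: B) + f (A :&: B) <= f A + f B
  }.

(* F is eps-approximately submodular, with f as a representative. *)
Definition representative (R : realType) (N : finType) (eps : R)
    (F f : {set N} -> R) : Prop :=
  submodular f /\
  forall S : {set N}, (1 - eps) * f S <= F S <= (1 + eps) * f S.

(* [greedy_run I F S M S'] : the loop entered with current solution S and
   candidate set M may return S'.  It is a relation because ties in the argmax
   may be broken in any way, so a theorem about all S' covers every run. *)
Inductive greedy_run (R : realType) (N : finType) (I : {set {set N}})
    (F : {set N} -> R) : {set N} -> {set N} -> {set N} -> Prop :=
| greedy_stop : forall S : {set N}, greedy_run I F S set0 S
| greedy_step : forall (S M S' : {set N}) (x : N),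
    x \in M ->
    (forall y : N, y \in M -> F (S :|: [set y]) <= F (S :|: [set x])) ->
    greedy_run I F (if S :|: [set x] \in I then S :|: [set x] else S)
      (M :\ x) S' ->
    greedy_run I F S M S'.

Definition matroid_greedy (R : realType) (N : finType) (I : {set {set N}})
    (F : {set N} -> R) (S : {set N}) : Prop :=
  greedy_run I F set0 [set: N] S.

(* The default value f set0 is one of the values ranged over when set0 \in I,
   as is the case for a matroid; this is then the maximum of f over I. *)
Definition max_over (R : realType) (N : finType) (I : {set {set N}})
    (f : {set N} -> R) : R :=
  \big[Num.max/f set0]_(T in I) f T.

Definition greedy_ratio (R : realType) (k : nat) (eps : R) : R :=
  1 / 2 * ((1 - eps) / (1 + eps)) * (1 / (1 + k%:R * eps / (1 - eps))).

(* Main.v *)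
(** Given an independent set T, maintain along the run a set O of remaining
    candidates, initially T, with S :|: O independent.  When x is accepted, the
    exchange axiom lets one drop a single o from O; as x was preferred to o,
    (1 - eps) f(S + o) <= (1 + eps) f(S + x), and by submodularity o is worth at
    most f(S + o) - f(S).  When x is rejected it is not in O.  The set O is
    exhausted together with the candidates, so summing, and bounding every
    intermediate value of f by its value at the output S', gives
    (1 - eps) f(T) <= 2 (1 + k eps) f(S').  The resulting ratio
    (1 - eps)^2 / (2 (1 + k eps)) is at least the claimed one once k >= 1. *)
Require Import Defs.
From mathcomp Require Import all_boot all_order all_algebra.
From mathcomp Require Import reals.
From mathcomp Require Import zify ring lra.

Set Implicit Arguments.
Unset Strict Implicit.
Unset Printing Implicit Defensive.

Import Order.TTheory GRing.Theory Num.Theory.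
Local Open Scope ring_scope.

(** Iterates the exchange axiom, by induction on a bound for the gap between [#|B|] and [#|A|]. *)
Lemma matroid_augment (N : finType) (I : {set {set N}}) (A B : {set N}) :
  matroid I -> A \in I -> B \in I ->
  exists C : {set N}, [/\ C \subset B, A :|: C \in I & (#|B| <= #|A :|: C|)%N].
Proof.
move=> mI; move: {2}(#|B| - #|A|)%N (leqnn (#|B| - #|A|)) => n.
elim: n A => [|n IHn] A.
  rewrite leqn0 subn_eq0 => leBA AI BI.
  by exists set0; rewrite sub0set setU0.
move=> len AI BI; case: (leqP #|B| #|A|) => [leBA|ltAB].
  by exists set0; rewrite sub0set setU0.
have [x /setDP[xB xNA] AxI] := matroid_exchange mI AI BI ltAB.
have [|C [CB ACI leC]] := IHn _ _ AxI BI; first by rewrite setUC cardsU1 xNA; lia.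
by exists (x |: C); rewrite subUset sub1set xB CB setUA.
Qed.

(** If [x] is in [O], drop [x] itself. Otherwise augment [S + x] from [S :|: O] to an independent
    [E] with at least [#|S :|: O|] elements. As [E] has at most one element outside [S :|: O], it
    misses at most one element of [S :|: O], and that one is dropped. *)
Lemma matroid_swap (N : finType) (I : {set {set N}}) (S O : {set N}) (x : N) :
  matroid I -> S :|: [set x] \in I -> S :|: O \in I -> O != set0 ->
  exists2 o, o \in O &
    x \notin O :\ o /\ (S :|: [set x]) :|: (O :\ o) \in I.
Proof.
move=> mI SxI SOI /set0Pn[o0 o0O].
have [xO|xNO] := boolP (x \in O).
  exists x => //; split; first by rewrite !inE eqxx.
  by rewrite -setUA setD1K.
have xN o : x \notin O :\ o by rewrite !inE negb_and xNO orbT.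
have [C [CB ACI leC]] := matroid_augment mI SxI SOI.
set E := (_ :|: C) in ACI leC.
have SE : S :|: [set x] \subset E by apply: subsetUl.
have EB : E \subset x |: (S :|: O).
  by rewrite /E -!setUA !subUset sub1set; apply/and3P; split;
    rewrite ?(subset_trans CB) ?subsetUr // ?inE ?eqxx // setUCA subsetUl.
have cardD : (#|(S :|: O) :\: E| <= 1)%N.
  have := cardsID E (S :|: O); have := cardsID (S :|: O) E.
  have : (#|E :\: (S :|: O)| <= #|[set x]|)%N.
    apply: subset_leq_card; apply/subsetP => y /setDP[yE yN].
    by have := subsetP EB _ yE; rewrite 2!inE (negPf yN) orbF inE.
  by rewrite cards1 [E :&: _]setIC; lia.
suff [o oO sub] : exists2 o, o \in O & O :\ o \subset E.
  exists o => //; split=> //; apply: matroid_sub mI _ _ ACI _.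
  by rewrite subUset SE.
have [OE|/subsetPn[d dO dNE]] := boolP (O \subset E).
  by exists o0 => //; apply: subset_trans OE; apply: subsetDl.
exists d => //; apply/subsetP => y /setD1P[yd yO]; apply: contraNT yd => yNE.
by apply/eqP; apply: (card_le1_eqP cardD); rewrite inE ?yNE ?dNE inE ?yO ?dO orbT.
Qed.

(** Submodularity for [S' :|: O :\ o] and [S + o]: their union is [S' :|: O] and their intersection
    contains [S]. *)
Lemma submodular_marginal (R : realType) (N : finType) (f : {set N} -> R)
    (S S' O : {set N}) (o : N) :
  submodular f -> S \subset S' -> o \in O ->
  f (S' :|: O) + f S <= f (S' :|: O :\ o) + f (S :|: [set o]).
Proof.
move=> [_ mono UI] SS' oO.
have := UI (S' :|: O :\ o) (S :|: [set o]).
have -> : (S' :|: O :\ o) :|: (S :|: [set o]) = S' :|: O.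
  by rewrite setUACA (setUidPl SS') [_ :|: [set o]]setUC setD1K.
apply: le_trans; rewrite lerD2l; apply: mono.
by rewrite subsetI subsetUl andbT (subset_trans SS') ?subsetUl.
Qed.

Lemma greedy_run_sub (R : realType) (N : finType) (I : {set {set N}})
    (F : {set N} -> R) (S M S' : {set N}) :
  greedy_run I F S M S' -> S \subset S'.
Proof.
elim=> // {}S {}M {}S' x _ _ _; apply: subset_trans.
by case: ifP => // _; apply: subsetUl.
Qed.

Lemma greedy_run_bound (R : realType) (N : finType) (I : {set {set N}})
    (eps : R) (F f : {set N} -> R) (S M S' : {set N}) :
  matroid I -> 0 <= eps < 1 -> representative eps F f ->
  greedy_run I F S M S' ->
  forall O : {set N}, O \subset M -> S :|: O \in I ->
  (1 - eps) * (f (S' :|: O) - f S') <=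
    (1 + eps) * (f S' - f S) + 2 * eps * #|O|%:R * f S'.
Proof.
move=> mI /andP[eps0 eps1] [subf Ff].
elim=> [{}S O|{}S {}M {}S' x xM xmax run IH O OM SOI].
  by rewrite subset0 => /eqP -> _; rewrite setU0 cards0 !subrr !mulr0 !mul0r addr0.
have [->|O_n0] := eqVneq O set0.
  have := submodular_mono subf (greedy_run_sub (greedy_step xM xmax run)).
  by rewrite setU0 cards0; nra.
case: ifPn run IH => [SxI|SxNI] run IH; last first.
  apply: IH => //; rewrite subsetD1 OM; apply: contra SxNI => xO.
  by apply: matroid_sub mI _ _ SOI _; rewrite setUS ?sub1set.
have [o oO [xNO SO'I]] := matroid_swap mI SxI SOI O_n0.
have O'M : O :\ o \subset M :\ x.
  by rewrite subsetD1 xNO andbT (subset_trans (subsetDl _ _)).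
have SxS' := greedy_run_sub run.
have SS' : S \subset S' := subset_trans (subsetUl _ _) SxS'.
have step : (1 - eps) * f (S :|: [set o]) <= (1 + eps) * f (S :|: [set x]).
  have /andP[+ _] := Ff (S :|: [set o]); have /andP[_ +] := Ff (S :|: [set x]).
  by have := xmax o (subsetP OM _ oO); lra.
(* Dropping [o] costs [(1 - eps) * (f (S + o) - f S)], at most [(1 + eps) * (f (S + x) - f S) + 2 *
   eps * f S]. The first term telescopes along the run; in the second, [f S] is at most [f S']. *)
have := IH _ O'M SO'I; rewrite [#|O|](cardsD1 o) oO natrD /=.
have := submodular_mono subf SS'; rewrite -subr_ge0 => /(mulr_ge0 eps0).
have := submodular_marginal subf SS' oO.
rewrite -subr_ge0 => /mulr_ge0 /(_ (_ : 0 <= 1 - eps)).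
rewrite subr_ge0 (ltW eps1) => /(_ isT).
by move: step; lra.
Qed.

Lemma matroid_greedy_ge (R : realType) (N : finType) (I : {set {set N}})
    (eps : R) (F f : {set N} -> R) (S T : {set N}) :
  matroid I -> 0 <= eps < 1 -> representative eps F f ->
  matroid_greedy I F S -> T \in I ->
  (1 - eps) * f T <= 2 * (1 + (matroid_rank I)%:R * eps) * f S.
Proof.
move=> mI eps01 Ff run TI; have [subf _] := Ff; case/andP: (eps01) => eps0 eps1.
have := greedy_run_bound mI eps01 Ff run (subsetT T).
rewrite set0U (submodular_set0 subf) => /(_ TI).
have := submodular_mono subf (subsetUr S T).
have := submodular_mono subf (sub0set S); rewrite (submodular_set0 subf).
have : #|T|%:R <= (matroid_rank I)%:R :> R.
  by rewrite ler_nat; apply: (leq_bigmax_cond T TI).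
move: #|T|%:R (matroid_rank I)%:R => t k tk fS0 fT le.
have : eps * t * f S <= eps * k * f S by rewrite ler_wpM2r // ler_wpM2l.
have : (1 - eps) * f T <= (1 - eps) * f (S :|: T).
  by rewrite ler_wpM2l ?subr_ge0 // ltW.
(* The factor 2 is [(1 - eps) + (1 + eps)], once [(1 - eps) * f S] is moved to the right. *)
by nra.
Qed.

Lemma greedy_ratioE (R : realType) (k : nat) (eps : R) :
  0 <= eps < 1 -> greedy_ratio k eps =
    (1 - eps) ^+ 2 / (2 * ((1 + eps) * (1 - eps + k%:R * eps))).
Proof.
move=> /andP[eps0 eps1]; rewrite /greedy_ratio.
have k0 : 0 <= k%:R :> R by rewrite ler0n.
have := mulr_ge0 k0 eps0; move: (k%:R) k0 => m m0 me.
by field; apply/and3P; split; apply/eqP; lra.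
Qed.

Theorem theorem4 (R : realType) :
  (forall (N : finType) (I : {set {set N}}) (k : nat) (eps : R)
      (F f : {set N} -> R) (S : {set N}),
    matroid I -> matroid_rank I = k ->
    0 <= eps < 1 ->
    representative eps F f ->
    matroid_greedy I F S ->
    F S >= greedy_ratio k eps * max_over I f)
  /\
  (forall delta : R, 0 <= delta < 1 ->
    exists2 c : R, 0 < c &
      forall k : nat, (2 <= k)%N ->
        c <= greedy_ratio k (delta / k%:R) /\
        1 / 2 - 2 * delta <= greedy_ratio k (delta / k%:R)).
Proof.
split=> [N I k eps F f S mI rk eps01 Ff run|delta /andP[d0 d1]].
  have [subf FfS] := Ff; case/andP: (eps01) => eps0 eps1.
  have f_ge0 (A : {set N}) : 0 <= f A.
    by rewrite -(submodular_set0 subf); apply/(submodular_mono subf)/sub0set.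
  have /andP[FS _] := FfS S.
  have k0 : 0 <= k%:R * eps by rewrite mulr_ge0 ?ler0n.
  (* Covers both the default value of the maximum and the case of rank 0. *)
  have base : greedy_ratio k eps * f set0 <= F S.
    by rewrite (submodular_set0 subf) mulr0 (le_trans _ FS) // mulr_ge0 //
      subr_ge0 ltW.
  rewrite /max_over; apply: (big_ind (fun v => _ * v <= F S)) => //
    [u v|T TI].
    by rewrite /Num.max; case: ifP.
  have [k_eq0|k_gt0] := posnP k.
    suff -> : T = set0 by [].
    apply/eqP; rewrite -cards_eq0 -leqn0 -k_eq0 -rk.
    exact: (leq_bigmax_cond T TI).
  have := matroid_greedy_ge mI eps01 Ff run TI; rewrite rk => leT.
  apply: le_trans FS; rewrite greedy_ratioE // mulrAC ler_pdivrMr; last by nra.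
  have k1 : 1 <= k%:R :> R by rewrite ler1n.
  (* The difference of the two sides is [(k - 1) * eps ^+ 2], so rank 0 had to be treated apart. *)
  have le1 : 1 + k%:R * eps <= (1 + eps) * (1 - eps + k%:R * eps) by nra.
  have : (1 + k%:R * eps) * f S <= (1 + eps) * (1 - eps + k%:R * eps) * f S.
    by rewrite ler_wpM2r.
  move: leT; rewrite expr2 -!mulrA => leT le2.
  by rewrite ler_pM2l ?subr_gt0 //; lra.
(* With [e = delta / k] below 1/2, the numerator [(1 - e) ^+ 2] is at least 1/4 and the denominator
   [2 * ((1 + e) * (1 - e + delta))] at most 6, so any constant up to 1/24 would do. *)
exists (1 / 32) => [|k k2]; first by lra.
have k2R : 2 <= k%:R :> R by rewrite ler_nat.
have k_neq0 : k%:R != 0 :> R by apply/eqP; lra.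
set e := delta / _.
have ek : k%:R * e = delta by rewrite mulrC divfK.
have e0 : 0 <= e by rewrite divr_ge0 // ler0n.
have e2 : 2 * e <= delta by rewrite -ek ler_wpM2r.
rewrite greedy_ratioE ?ek; last by apply/andP; split=> //; lra.
by split; rewrite ler_pdivlMr; nra.
Qed.
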